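(* Let $p$ be a prime, let $K \ge 1$, $n \ge 1$ and $j$ be integers with $0 \le j \le n-1$, and let $N = Kp^n+1$. Suppose that $N \neq p^{3(n-j)}+1$ and that $p^j \ge p^{n-j} \ge (N-1)^{1/3}$. If there exist integers $a>1$ and $L$ such that: (i) $a^{Kp^{n-j-1}} \equiv L \pmod N$ and $L \not\equiv 1 \pmod N$, and (ii) $L^{p^{j+1}} \equiv 1 \pmod N$, then $N$ is prime. *)

(* Defs.v *)
From mathcomp Require Export all_boot all_order all_algebra all_field.
Set Implicit Arguments.
Unset Strict Implicit.
Unset Printing Implicit Defensive.
Export Order.TTheory GRing.Theory Num.Theory.

(* Main.v *)
Require Import Defs.
From mathcomp Require Import all_boot all_order all_algebra all_field.
From mathcomp Require Import cyclic zify.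
Import Order.TTheory GRing.Theory Num.Theory.
Local Open Scope ring_scope.

(** Conditions (i) and (ii) yield a prime power [Q = q ^ e] exactly dividing
    [N] modulo which the order of [a] divides [K p ^ n] but not
    [K p ^ (n - j - 1)].  That order divides [(q - 1) q ^ (e - 1)], so
    [M = p ^ (n - j)] divides [q - 1].  Since [M ^ 2] divides [N - 1], writing
    [N = (1 + u M) (1 + w M)] with [1 + u M = q] gives [M] divides [u + w].
    If [w > 0], then [u w + 1 >= u + w >= M], hence [N > M ^ 3], which
    contradicts the size hypothesis; so [w = 0] and [N = q]. *)

(** Bezout in the subtraction-free form [u * m = v * k + gcdn m k] avoids inverting [a] modulo
    [Q]. *)
Lemma expn_eq1_gcd {Q a m k : nat} :
  (0 < m)%N -> (a ^ m = 1 %[mod Q])%N -> (a ^ k = 1 %[mod Q])%N ->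
  (a ^ gcdn m k = 1 %[mod Q])%N.
Proof.
move=> m_gt0 am1 ak1; have [u v def_um _] := egcdnP k m_gt0.
have expn_mul1 c d : (a ^ c = 1 %[mod Q])%N -> (a ^ (d * c) = 1 %[mod Q])%N.
  by move=> ac1; rewrite mulnC expnM -modnXm ac1 modnXm exp1n.
have := expn_mul1 _ u am1.
by rewrite def_um expnD -modnMml (expn_mul1 _ v ak1) modnMml mul1n.
Qed.

Lemma eq1_modn_dvd (Q x : nat) :
  (0 < x)%N -> (x == 1 %[mod Q])%N = (Q %| x - 1)%N.
Proof. exact: eqn_mod_dvd. Qed.

(** The [p]-part of [g] divides [p ^ c]; its complementary part is coprime to [p ^ d], so it divides
    [K]. The two parts are coprime. *)
Lemma dvdn_mul_expn_logn {p g K c d : nat} :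
  prime p -> (0 < g)%N -> (0 < K)%N -> (g %| K * p ^ d)%N ->
  (logn p g <= c)%N -> (g %| K * p ^ c)%N.
Proof.
move=> p_pr g_gt0 K_gt0 g_dvd le_c.
rewrite -(partnC p g_gt0) Gauss_dvd ?coprime_partC //.
apply/andP; split.
  by rewrite p_part dvdn_mull // dvdn_exp2l.
apply: dvdn_mulr; have cop : coprime (g`_p^')%N (p ^ d)%N.
  rewrite coprime_sym coprimeXl // prime_coprime //.
  by rewrite -p'natE ?part_pnat.
by rewrite -(Gauss_dvdl _ cop) (dvdn_trans (dvdn_part _ _)).
Qed.

(** For some prime [q], the [q]-part of [N] does not divide [a ^ (K * p ^ c) - 1]. If [p ^ c.+1] did
    not divide [q - 1], an exponent trivialising [a] modulo that part would divide [K * p ^ c], a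
    contradiction. *)
Lemma prime_factor_eq1_mod_expn {p K N a c d : nat} :
  prime p -> (0 < K)%N -> (0 < N)%N -> (0 < a)%N -> ~~ (p %| N)%N ->
  (a ^ (K * p ^ c) <> 1 %[mod N])%N -> (a ^ (K * p ^ d) = 1 %[mod N])%N ->
  exists q, [/\ prime q, (q %| N)%N & (p ^ c.+1 %| q - 1)%N].
Proof.
move=> p_pr K_gt0 N_gt0 a_gt0 pN ac ad.
have p_gt0 := prime_gt0 p_pr.
have Kd_gt0 e : (0 < K * p ^ e)%N by rewrite muln_gt0 K_gt0 expn_gt0 p_gt0.
have : ~~ (N %| a ^ (K * p ^ c) - 1)%N.
  by rewrite -eq1_modn_dvd ?expn_gt0 ?a_gt0 //; apply/eqP.
move=> ndvd.
have /allPn[q q_in ndvdQ] :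
    ~~ all (fun q : nat => N`_q %| a ^ (K * p ^ c) - 1)%N (primes N).
  by apply: contra ndvd => /allP all_dvd; apply/dvdn_partP.
move: q_in; rewrite mem_primes => /and3P[q_pr _ qN].
exists q; split=> //; apply: contraR ndvdQ => ndvdq.
have adQ : (a ^ (K * p ^ d) = 1 %[mod N`_q])%N.
  apply/eqP; rewrite eq1_modn_dvd ?expn_gt0 ?a_gt0 //.
  apply: dvdn_trans (dvdn_part _ _) _.
  by rewrite -eq1_modn_dvd ?expn_gt0 ?a_gt0 //; apply/eqP.
have copa : coprime a N`_q.
  rewrite -(coprime_pexpl _ _ (Kd_gt0 d)) /coprime -gcdn_modl adQ gcdn_modl.
  by rewrite gcd1n.
have := expn_eq1_gcd (Kd_gt0 d) adQ (Euler_exp_totient copa).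
(* [g] stands in for the order of [a]: a multiple of it dividing both [K * p ^ d] and the
   totient. *)
set g := gcdn _ _ => ag1.
have g_gt0 : (0 < g)%N by rewrite gcdn_gt0 Kd_gt0.
have q_gt1 := prime_gt1 q_pr.
have log_g : (logn p g <= c)%N.
  rewrite leqNgt; apply: contra ndvdq => lt_c.
  have : (p ^ c.+1 %| totient N`_q)%N.
    by apply: (dvdn_trans _ (dvdn_gcdr (K * p ^ d) _)); rewrite pfactor_dvdn.
  have e_gt0 : (0 < logn q N)%N by rewrite logn_gt0 mem_primes q_pr N_gt0.
  (* The totient is [q - 1] times a power of [q], and [p] differs from [q] because it does not
     divide [N]. *)
  rewrite p_part totient_pfactor // Gauss_dvdl ?subn1 //.
  rewrite coprimeXl // coprimeXr // prime_coprime // dvdn_prime2 //.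
  by apply: contra pN => /eqP->.
have /dvdnP[k ->] : (g %| K * p ^ c)%N.
  by apply: dvdn_mul_expn_logn log_g => //; apply: dvdn_gcdl.
rewrite -eq1_modn_dvd ?expn_gt0 ?a_gt0 //.
by rewrite mulnC expnM -modnXm ag1 modnXm exp1n.
Qed.

Lemma factor_eq1_mod_eq {M N q : nat} :
  (1 < q)%N -> (q %| N)%N -> (M %| q - 1)%N -> (M ^ 2 %| N - 1)%N ->
  (0 < N <= M ^ 3)%N -> N = q.
Proof.
move=> q_gt1 /dvdnP[r def_N] /dvdnP[u def_u] /dvdnP[v def_v] /andP[N_gt0 N_le].
have M_gt0 : (0 < M)%N by case: M N_le {def_u def_v} => //; lia.
have r_gt0 : (0 < r)%N by case: r def_N => //; lia.
have {def_u}def_q : q = (u * M + 1)%N by lia.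
have /dvdnP[w def_w] : (M %| r - 1)%N.
  (* Adding [r * u * M] turns [r - 1] into [r * q - 1], which is [N - 1]. *)
  have /dvdn_addl <- : (M %| r * u * M)%N by apply: dvdn_mull.
  have -> : (r - 1 + r * u * M = v * M * M)%N.
    by rewrite def_q in def_N; nia.
  exact: dvdn_mull.
have {def_w r_gt0}def_r : r = (w * M + 1)%N by lia.
have [w0|w_gt0] := posnP w; first by rewrite def_N def_r w0; lia.
have u_gt0 : (0 < u)%N by case: u def_q => //; lia.
have sum_eq : (u + w + u * w * M = v * M)%N.
  apply/eqP; rewrite -(eqn_pmul2r M_gt0); apply/eqP.
  by rewrite def_q def_r in def_N; nia.
have M_le : (M <= u + w)%N.
  apply: dvdn_leq; first lia.
  have /dvdn_addl <- : (M %| u * w * M)%N by apply: dvdn_mull.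
  by rewrite sum_eq dvdn_mull.
(* This is [(u - 1) * (w - 1) >= 0]. *)
have uw_ge : (u + w <= u * w + 1)%N by nia.
have NE : (N = v * M * M + 1)%N by nia.
have v_ge : (M <= v)%N.
  rewrite -(leq_pmul2r M_gt0) -sum_eq.
  have : (M * M <= (u * w + 1) * M)%N by rewrite leq_pmul2r //; lia.
  by nia.
have : (M * M * M <= v * M * M)%N by rewrite !leq_mul.
by move: N_le; rewrite !expnS expn0; lia.
Qed.

Lemma modz_nat_eq (m n d : nat) :
  (m%:Z = n%:Z %[mod d%:Z])%Z <-> (m = n %[mod d])%N.
Proof. by rewrite !modz_nat; split=> [[]|->]. Qed.

Lemma PoszX (m k : nat) : (m ^ k)%N%:Z = m%:Z ^+ k.
Proof. by rewrite -!natz natrX. Qed.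

(* In [algC], [3.-root x] is the principal cube root, hence for [x >= 0] the
   nonnegative real one. *)
Theorem theorem3p1 (p K n j N : nat)
    (p_prime : prime p) (K_ge1 : (1 <= K)%N) (n_ge1 : (1 <= n)%N)
    (j_le : (j <= n - 1)%N) (N_def : N = (K * p ^ n + 1)%N)
    (N_neq : N <> (p ^ (3 * (n - j)) + 1)%N)
    (pj_ge : (p ^ j >= p ^ (n - j))%N)
    (p_ge_root : ((p ^ (n - j))%:R : algC) >= 3.-root (N%:R - 1))
    (aL : exists a L : int,
       [/\ 1 < a,
           (a ^+ (K * p ^ (n - j - 1))%N = L %[mod N%:Z])%Z,
           (L <> 1 %[mod N%:Z])%Z
         & (L ^+ (p ^ (j + 1))%N = 1 %[mod N%:Z])%Z]) :
  prime N.
Proof.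
have p_gt1 := prime_gt1 p_prime.
have Kpn_gt0 : (0 < K * p ^ n)%N by rewrite muln_gt0 K_ge1 expn_gt0 prime_gt0.
have N_gt0 : (0 < N)%N by lia.
have N_le : (N <= (p ^ (n - j)) ^ 3)%N.
  have : (K * p ^ n <= (p ^ (n - j)) ^ 3)%N.
    rewrite -(ler_nat algC) natrX; move: p_ge_root.
    rewrite N_def natrD addrK => root_le.
    rewrite -{1}(rootCK (isT : (0 < 3)%N) (K * p ^ n)%:R).
    by rewrite lerXn2r // nnegrE ?rootC_ge0 ?ler0n.
  (* The root bound only gives [N - 1 <= M ^ 3]; excluding equality gains the missing unit. *)
  by move: N_neq; rewrite mulnC expnM; lia.
have sq_dvd : ((p ^ (n - j)) ^ 2 %| N - 1)%N.
  rewrite N_def addnK -expnM; apply/dvdn_mull/dvdn_exp2l.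
  (* Comparing exponents gives [n - j <= j], hence [(n - j) * 2 <= n]. *)
  by move: pj_ge; rewrite leq_exp2l //; lia.
have exp_split : (n - j - 1 + (j + 1) = n)%N by lia.
have exp_succ : ((n - j - 1).+1 = n - j)%N by lia.
have [a' [L [a_gt1 aE L_neq1 L_exp]]] := aL.
case: a' a_gt1 aE => // a a_gt1 aE.
have pN : ~~ (p %| N)%N.
  rewrite N_def dvdn_addr ?dvdn1 ?gtn_eqF //.
  by rewrite dvdn_mull // dvdn_exp.
have aneq1 : (a ^ (K * p ^ (n - j - 1)) <> 1 %[mod N])%N.
  by move/modz_nat_eq; rewrite PoszX aE.
(* Condition (i) raised to the power [p ^ (j + 1)], combined with (ii). *)
have aeq1 : (a ^ (K * p ^ n) = 1 %[mod N])%N.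
  apply/modz_nat_eq; rewrite -L_exp.
  have -> : (K * p ^ n = K * p ^ (n - j - 1) * p ^ (j + 1))%N.
    by rewrite -mulnA -expnD exp_split.
  by rewrite expnM !PoszX -modzXm aE modzXm.
have a_gt0 : (0 < a)%N by rewrite -ltz_nat (lt_trans _ a_gt1).
have [q [q_pr qN]] := prime_factor_eq1_mod_expn p_prime K_ge1 N_gt0 a_gt0 pN
  aneq1 aeq1.
rewrite exp_succ => Mq; rewrite (factor_eq1_mod_eq (prime_gt1 q_pr) qN Mq sq_dvd) //.
by rewrite N_gt0.
Qed.
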